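(* For any three continuous functions $f_1,f_2,f_3:\mathrm{SO}(4)\to S^3\times S^3$, there exists a rotation $R\in\mathrm{SO}(4)$ such that $d_4(R,\mathbf{R}_{QQ}(f_i(R)))\ge\pi$ for all $i\in\{1,2,3\}$.
   Context: Identify $\mathbb{R}^4$ with the quaternions via $(w,x,y,z)\leftrightarrow w+x\mathbf{i}+y\mathbf{j}+z\mathbf{k}$; $S^3$ is the set of unit quaternions. For $(\mathbf{q}_L,\mathbf{q}_R)\in S^3\times S^3$, $\mathbf{R}_{QQ}(\mathbf{q}_L,\mathbf{q}_R)\in\mathrm{SO}(4)$ is the rotation $\mathbf{p}\mapsto\mathbf{q}_L\mathbf{p}\mathbf{q}_R$; every element of $\mathrm{SO}(4)$ is of this form, and $(\mathbf{q}_L,\mathbf{q}_R)$ is determined up to replacing it by $(-\mathbf{q}_L,-\mathbf{q}_R)$. For unit quaternions let $d_Q(\mathbf{p},\mathbf{q})=\cos^{-1}(\mathbf{p}\cdot\mathbf{q})$ (Euclidean dot product in $\mathbb{R}^4$). The distance between $R_1=\mathbf{R}_{QQ}(\mathbf{p}_L,\mathbf{p}_R)$ and $R_2=\mathbf{R}_{QQ}(\mathbf{q}_L,\mathbf{q}_R)$ is $d_4(R_1,R_2)=\min\{a+b,2\pi-a-b\}+|a-b|$ where $a=d_Q(\mathbf{p}_L,\mathbf{q}_L)$, $b=d_Q(\mathbf{p}_R,\mathbf{q}_R)$; this is independent of the choice of representatives and equals $|\theta|+|\phi|$ where $e^{\pm i\theta},e^{\pm i\phi}$ are the eigenvalues of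 $R_2R_1^{-1}$ with $\theta\in[0,\pi]$, $|\theta|\ge|\phi|$. *)

(* Defs.v *)
From HB Require Import structures.
From mathcomp Require Import all_boot all_order all_algebra.
From mathcomp Require Import all_classical all_reals all_analysis.
Set Implicit Arguments. Unset Strict Implicit. Unset Printing Implicit Defensive.
Import Order.TTheory GRing.Theory Num.Theory.
Import numFieldNormedType.Exports.
Local Open Scope classical_set_scope.
Local Open Scope ring_scope.

Section Quat.
Variable R : realType.

(* Quaternions w + x i + y j + z k are row vectors (w,x,y,z) in R^4. *)
Definition quat := 'rV[R]_4.
Definition qc (q : quat) (k : nat) : R := q ord0 (inord k).
Definition qmk (a b c d : R) : quat := \row_(j < 4) nth 0 [:: a; b; c; d] j.

Definition qmul (p q : quat) : quat :=
  qmk (qc p 0 * qc q 0 - qc p 1 * qc q 1 - qc p 2 * qc q 2 - qc p 3 * qc q 3)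
      (qc p 0 * qc q 1 + qc p 1 * qc q 0 + qc p 2 * qc q 3 - qc p 3 * qc q 2)
      (qc p 0 * qc q 2 - qc p 1 * qc q 3 + qc p 2 * qc q 0 + qc p 3 * qc q 1)
      (qc p 0 * qc q 3 + qc p 1 * qc q 2 - qc p 2 * qc q 1 + qc p 3 * qc q 0).

Definition qdot (p q : quat) : R := \sum_(i < 4) p ord0 i * q ord0 i.

Definition unitq (q : quat) : Prop := qdot q q = 1.

Definition SO4 : set 'M[R]_4 := [set M | M^T *m M = 1%:M /\ \det M = 1].

(* R_QQ(qL,qR) : the matrix of p |-> qL p qR (column j = image of e_j) *)
Definition RQQ (qL qR : quat) : 'M[R]_4 :=
  \matrix_(i < 4, j < 4) (qmul (qmul qL (delta_mx ord0 j)) qR) ord0 i.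

Definition dQ (p q : quat) : R := acos (qdot p q).

(* d_4 computed from representatives (pL,pR) of R1 and (qL,qR) of R2 *)
Definition d4 (pL pR qL qR : quat) : R :=
  let a := dQ pL qL in let b := dQ pR qR in
  Num.min (a + b) (2 * pi - a - b) + `|a - b|.

End Quat.

(* Main.v *)
(** With [pi <= d4] equivalent to the two cosines [u = pL . qL], [v = pR . qR]
having opposite signs (or one vanishing), restrict to [pL = pR = q]: then
[u |v| + |u| v] is an odd function of [q], and Borsuk-Ulam for three odd
functions on S^3 makes the three of them vanish simultaneously.

Borsuk-Ulam is obtained by lifting. An odd map g from S^3 to the sphere of pure
unit quaternions, followed along meridians from the pole to the equator S^2, is
conjugated to a constant: [g(x) Q(x) = Q(x) i], where [Q] is a finite product
of factors [1 - v u], each of which conjugates the pure unit [u] to a nearby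
[v]. As [g(-x) = - g(x)], the quaternion [conj(Q(x)) Q(-x)] anticommutes with
[i], so it lies in the plane spanned by [j] and [k]; it is nonzero and odd in
[x]. The same idea in the plane, with factors [|u||v| + v conj(u)] whose square
is a positive multiple of [v conj(u)], lifts this odd map S^2 -> C* to square
roots along the equator S^1, and the ratio of the roots at antipodal points is
an odd nonvanishing imaginary function on S^1, against the intermediate value
theorem. *)
Require Import Defs.
From HB Require Import structures.
From mathcomp Require Import all_boot all_order all_algebra.
From mathcomp Require Import all_classical all_reals all_analysis.
From mathcomp Require Import ring lra.
Import Order.TTheory GRing.Theory Num.Theory.
Import numFieldNormedType.Exports.
Local Open Scope classical_set_scope.
Local Open Scope ring_scope.

(** * Continuity of real-valued expressions *)

Section Continuity.
Variable R : realType.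

Lemma continuous_mx (T : topologicalType) m n (f : T -> 'M[R]_(m, n)) :
  (forall i j, continuous (fun t => f t i j)) -> continuous f.
Proof.
move=> cf t; apply/cvg_ballP => e e0.
have H : \forall s \near t, forall i j, ball (f t i j) e (f s i j).
  apply: filter_forall => i; apply: filter_forall => j.
  by have /cvg_ballP := cf i j t; apply.
by near=> s; split=> //; near: s.
Unshelve. all: by end_near.
Qed.

Lemma within_comp (T U V : topologicalType) (A : set U) (B : set T)
    (f : U -> V) (g : T -> U) :
  {within A, continuous f} -> continuous g -> (forall t, B t -> A (g t)) ->
  {within B, continuous (fun t => f (g t))}.
Proof.
move=> /subspace_continuousP cf cg BA; apply/subspace_continuousP => t Bt.
apply: cvg_comp (cf _ (BA _ Bt)).
move=> W /= /(cg t) /=; rewrite /nbhs /=.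
by apply: filterS => s + /BA; exact.
Qed.

Lemma continuous_pair (T U V : topologicalType) (f : T -> U) (g : T -> V) :
  continuous f -> continuous g -> continuous (fun t => (f t, g t)).
Proof.
move=> cf cg t; apply: (@cvg_pair _ _ _ _ (nbhs (f t)) (nbhs (g t))).
- exact: cf.
- exact: cg.
Qed.

Lemma continuousT_comp (T U V : topologicalType) (f : T -> U) (g : U -> V) :
  continuous f -> continuous g -> continuous (fun t => g (f t)).
Proof. by move=> cf cg t; exact: continuous_comp (cf t) (cg _). Qed.

Lemma continuousT_fst (T U V : topologicalType) (f : T -> U * V) :
  continuous f -> continuous (fun t => (f t).1).
Proof. by move=> cf; apply: continuousT_comp cf _ => x; exact: cvg_fst. Qed.

Lemma continuousT_snd (T U V : topologicalType) (f : T -> U * V) :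
  continuous f -> continuous (fun t => (f t).2).
Proof. by move=> cf; apply: continuousT_comp cf _ => x; exact: cvg_snd. Qed.

Lemma continuousT_id (T : topologicalType) : continuous (fun t : T => t).
Proof. by move=> t. Qed.

Lemma continuousT_cst (T U : topologicalType) (u : U) :
  continuous (fun t : T => u).
Proof. exact: cst_continuous. Qed.

Section Real.
Variables (T : topologicalType) (f g : T -> R).
Hypotheses (cf : continuous f) (cg : continuous g).

Lemma continuousTD : continuous (fun t => f t + g t).
Proof. by move=> t; exact: continuousD (cf t) (cg t). Qed.

Lemma continuousTN : continuous (fun t => - f t).
Proof. by move=> t; exact: continuousN (cf t). Qed.

Lemma continuousTM : continuous (fun t => f t * g t).
Proof. by move=> t; exact: continuousM (cf t) (cg t). Qed.

Lemma continuousT_norm : continuous (fun t => `|f t|).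
Proof. exact: continuousT_comp cf (@norm_continuous _ R^o). Qed.

Lemma continuousT_sqrt : continuous (fun t => Num.sqrt (f t)).
Proof. exact: continuousT_comp cf (@sqrt_continuous R). Qed.

Lemma continuousT_cos : continuous (fun t => cos (f t)).
Proof. exact: continuousT_comp cf (@continuous_cos R). Qed.

Lemma continuousT_sin : continuous (fun t => sin (f t)).
Proof. exact: continuousT_comp cf (@continuous_sin R). Qed.

Lemma continuousTV : (forall t, f t != 0) -> continuous (fun t => (f t)^-1).
Proof. by move=> f0 t; exact: continuousV (f0 t) (cf t). Qed.

End Real.

End Continuity.
(** The [pair ?a] case meets [fun t => (a, t)] in eta-contracted form. Projections try the context
    first: sometimes only the components are known to be continuous. *)
Ltac cont := repeat (cbv beta; lazymatch goal with
  | |- continuous (fun t => t) => exact: continuousT_id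
  | |- continuous (fun t => (@?f t, @?g t)) =>
    apply: (@continuous_pair _ _ _ f g)
  | |- continuous (pair ?a) =>
    apply: (@continuous_pair _ _ _ (fun=> a) (fun t => t))
  | |- continuous (fun t => @?f t + @?g t) => apply: (@continuousTD _ _ f g)
  | |- continuous (fun t => - @?f t) => apply: (@continuousTN _ _ f)
  | |- continuous (fun t => @?f t * @?g t) => apply: (@continuousTM _ _ f g)
  | |- continuous (fun t => @?f t ^+ 2) => apply: (@continuousTM _ _ f f)
  | |- continuous (fun t => `| @?f t |) => apply: (@continuousT_norm _ _ f)
  | |- continuous (fun t => Num.sqrt (@?f t)) =>
    apply: (@continuousT_sqrt _ _ f)
  | |- continuous (fun t => cos (@?f t)) => apply: (@continuousT_cos _ _ f)
  | |- continuous (fun t => sin (@?f t)) => apply: (@continuousT_sin _ _ f)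
  | |- continuous (fun t => (@?f t).1) =>
    first [assumption | apply: (@continuousT_fst _ _ _ f)]
  | |- continuous (fun t => (@?f t).2) =>
    first [assumption | apply: (@continuousT_snd _ _ _ f)]
  | |- _ => first [assumption | exact: continuousT_cst]
  end).

(** * Fine subdivisions, and lifting in the plane *)

(** Positivity on the diagonal is an open condition, so by compactness of [[0, L]] times [K] it
    persists at all pairs [(a, a + e)] for [e] below one uniform bound. In the uses, [phi > 0] says
    that two consecutive values do not point in opposite directions. *)
Lemma fine_subdivision (R : realType) (T : topologicalType) (K : set T) (L : R)
    (phi : (R * R) * T -> R) :
  compact K -> continuous phi -> 0 < L ->
  (forall a y, 0 <= a <= L -> K y -> 0 < phi ((a, a), y)) ->
  exists N : nat, [/\ (0 < N)%N & forall k y, (k < N)%N -> K y ->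
    0 < phi ((L * k%:R / N%:R, L * k.+1%:R / N%:R), y)].
Proof.
move=> cK cphi L0 phi0.
have /compact_near_coveringP cKL := compact_setX (@segment_compact R 0 L) cK.
pose P (e : R) (x : R * T) := 0 < phi ((x.1, x.1 + e), x.2).
have /nbhs_ballP[e /= e0 He] :
    \forall e \near (0 : R), `[0, L]%classic `*` K `<=` P e.
  apply: (cKL R (nbhs (0 : R)) P) => -[a y] [/= aL Ky].
  pose psi (z : (R * T) * R) := phi ((z.1.1, z.1.1 + z.2), z.1.2).
  have cpsi : continuous psi.
    apply: (@continuousT_comp _ _ _
      (fun z : (R * T) * R => ((z.1.1, z.1.1 + z.2), z.1.2)) phi _ cphi).
    cont.
  have psi0 : 0 < psi ((a, y), 0) by rewrite /psi /= addr0; apply: phi0.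
  have := cpsi _ _ (lt_nbhsr psi0).
  rewrite /nbhs /=; apply: filterS => z; exact.
(* This choice makes the mesh [L / N] smaller than [e]. *)
have [N hN] : exists N : nat, L / e < N%:R.
  by exists (Num.bound (L / e)); rewrite archi_boundP// divr_ge0// ltW.
have N0 : 0 < N%:R :> R by apply: le_lt_trans hN; rewrite divr_ge0 ?ltW.
exists N; split; first by rewrite -(ltr0n R).
move=> k y kN Ky.
have -> : L * k.+1%:R / N%:R = L * k%:R / N%:R + L / N%:R.
  by rewrite -natr1 mulrDr mulrDl mulr1.
apply: (He (L / N%:R) _ (L * k%:R / N%:R, y)) => /=.
  rewrite /ball /= sub0r normrN gtr0_norm ?divr_gt0//.
  by rewrite ltr_pdivrMr// mulrC -ltr_pdivrMr.
have k0 : 0 <= L * k%:R / N%:R by rewrite divr_ge0 ?mulr_ge0 ?ler0n ?(ltW L0).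
split=> //=; rewrite in_itv/= k0 /=.
by rewrite ler_pdivrMr// ler_pM2l// ler_nat ltnW.
Qed.

(* [c + i d] is a complex-valued map on a disk of radius [L], the point with
   polar coordinates [(b, t)] being mapped to [c (b, t) + i d (b, t)]. *)
Lemma disk_odd_boundary_vanishes (R : realType) (L : R) (c d : R * R -> R) :
  0 < L -> continuous c -> continuous d ->
  (forall t, c (0, t) = c (0, 0)) -> (forall t, d (0, t) = d (0, 0)) ->
  (forall b, c (b, pi + pi) = c (b, 0)) ->
  (forall b, d (b, pi + pi) = d (b, 0)) ->
  (forall t, c (L, t + pi) = - c (L, t)) ->
  (forall t, d (L, t + pi) = - d (L, t)) ->
  ~ (forall b t : R, 0 <= b <= L -> 0 <= t <= pi + pi ->
       0 < c (b, t) ^+ 2 + d (b, t) ^+ 2).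
Proof.
move=> L0 cc cd c0 d0 cper dper codd dodd pos.
(* With [G = c + i d], [re x y + i im x y] is [|G x| |G y| + G y conj(G x)]. *)
pose nn (x : R * R) := c x ^+ 2 + d x ^+ 2.
pose re (x y : R * R) := Num.sqrt (nn x * nn y) + (c x * c y + d x * d y).
pose im (x y : R * R) := c x * d y - d x * c y.
have cn (T : topologicalType) (f : T -> R * R) :
    continuous f ->
    continuous (fun t => c (f t)) /\ continuous (fun t => d (f t)).
  by move=> cf; split; apply: continuousT_comp.
have cre (T : topologicalType) (f g : T -> R * R) :
    continuous f -> continuous g -> continuous (fun t => re (f t) (g t)).
  by move=> /cn[? ?] /cn[? ?]; rewrite /re /nn; cont.
have cim (T : topologicalType) (f g : T -> R * R) :
    continuous f -> continuous g -> continuous (fun t => im (f t) (g t)).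
  by move=> /cn[? ?] /cn[? ?]; rewrite /im; cont.
pose K : set R := [set` `[0, pi + pi]].
have cK : compact K by exact: segment_compact.
pose phi (z : (R * R) * R) := re (z.1.1, z.2) (z.1.2, z.2).
have cphi : continuous phi by apply: cre; cont.
have phi0 a t : 0 <= a <= L -> K t -> 0 < phi ((a, a), t).
  rewrite /K /= in_itv /= => aL tK; have := pos a t aL tK.
  rewrite /phi /re /nn /= -!expr2 => p; rewrite ltr_wpDl ?sqrtr_ge0//.
have [N [N0 hN]] := @fine_subdivision R _ K L phi cK cphi L0 phi0.
pose u k : R := L * k%:R / N%:R.
have u0 : u 0%N = 0 by rewrite /u mulr0 mul0r.
have uN : u N = L by rewrite /u mulfK// pnatr_eq0 -lt0n.
have uL k : (k <= N)%N -> 0 <= u k <= L.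
  move=> kN; rewrite /u divr_ge0 ?mulr_ge0 ?ler0n ?(ltW L0)//=.
  by rewrite ler_pdivrMr ?ltr0n// ler_pM2l// ler_nat.
(* [s k t] is the complex product of the factors met on the radius of angle [t] up to [u k]. *)
pose s := fix s k (t : R) : R * R := if k is j.+1 then
    let x := re (u j, t) (u j.+1, t) in let y := im (u j, t) (u j.+1, t) in
    (x * (s j t).1 - y * (s j t).2, x * (s j t).2 + y * (s j t).1)
  else (1, 0).
have cs k : continuous (fun t => (s k t).1) /\ continuous (fun t => (s k t).2).
  elim: k => [|k [IH1 IH2]] /=; first by split; cont.
  have ? : continuous (fun t => re (u k, t) (u k.+1, t)) by apply: cre; cont.
  have ? : continuous (fun t => im (u k, t) (u k.+1, t)) by apply: cim; cont.
  by split; cont.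
have sper k : s k (pi + pi) = s k 0.
  by elim: k => //= k ->; rewrite /re /im /nn !cper !dper.
(* [(s k t)^2 = e G_k conj(G_0)] for the complex numbers [G_j = c + i d]. *)
have sq k t : (k <= N)%N -> K t -> exists2 e, 0 < e &
    (s k t).1 ^+ 2 - (s k t).2 ^+ 2 =
      e * (c (u k, t) * c (0, 0) + d (u k, t) * d (0, 0)) /\
    (s k t).1 * (s k t).2 *+ 2 =
      e * (c (0, 0) * d (u k, t) - d (0, 0) * c (u k, t)).
  move=> + tK; have tK' := tK; rewrite /K /= in_itv/= in tK'.
  elim: k => [_|k IH kN].
    have := pos 0 t; rewrite lexx (ltW L0) => /(_ isT tK') p.
    (* The product is empty and [G (0, t) = G (0, 0)], so [1 = e |G_0|^2]. *)
    exists (nn (0, t))^-1; first by rewrite invr_gt0.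
    by rewrite u0 /= /nn -(c0 t) -(d0 t); split; field; rewrite gt_eqF.
  have [e e0 [h1 h2]] := IH (ltnW kN).
  have := hN k t kN tK; rewrite /phi /= -/(u k) -/(u k.+1).
  have := pos _ t (uL k (ltnW kN)) tK'.
  have := pos _ t (uL k.+1 kN) tK'.
  rewrite /re /im -/(nn (u k, t)) -/(nn (u k.+1, t)) => p' p.
  have : Num.sqrt (nn (u k, t) * nn (u k.+1, t)) ^+ 2 =
      nn (u k, t) * nn (u k.+1, t).
    by rewrite sqr_sqrtr// mulr_ge0// ltW.
  move: (Num.sqrt _) => m; move: p p' h1 h2; rewrite /nn.
  move: (s k t).1 (s k t).2 (c (0,0)) (d (0,0)).
  move: (c (u k, t)) (c (u k.+1, t)) (d (u k, t)) (d (u k.+1, t)).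
  move=> a a' b b' x y A B p p' h1 h2 hm q.
  (* The factor is [F = m + w + i v], where [w + i v = G_{k+1} conj(G_k)] has modulus [m], so
     [F^2 = 2 (m + w) (w + i v)]; multiplying by [G_k conj(G_0)] brings out [|G_k|^2]. *)
  exists (2 * (m + (a * a' + b * b')) * (a ^+ 2 + b ^+ 2) * e).
    by rewrite !mulr_gt0.
  set w := a * a' + b * b'; set v := a * b' - b * a'.
  have hw : m ^+ 2 = w ^+ 2 + v ^+ 2 by rewrite hm /w /v; ring.
  have hx : (m + w) ^+ 2 - v ^+ 2 = 2 * (m + w) * w by rewrite sqrrD hw; ring.
  split.
  - transitivity (((m + w) ^+ 2 - v ^+ 2) * (x ^+ 2 - y ^+ 2)
      - 2 * (m + w) * v * (x * y *+ 2)); first ring.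
    by rewrite hx h1 h2 /w /v; ring.
  - transitivity (((m + w) ^+ 2 - v ^+ 2) * (x * y *+ 2)
      + 2 * (m + w) * v * (x ^+ 2 - y ^+ 2)); first ring.
    by rewrite hx h1 h2 /w /v; ring.
(* [f t] is the imaginary part of [conj(s N t) s N (t + pi)]; exchanging the two points conjugates
   this number, hence [f pi = - f 0]. *)
pose f t := (s N (t + pi)).2 * (s N t).1 - (s N (t + pi)).1 * (s N t).2.
have [cs1 cs2] := cs N.
have ca : continuous (fun t : R => t + pi) by cont.
have cf : continuous f.
  have ? := @continuousT_comp _ _ _ _ _ ca cs1.
  have ? := @continuousT_comp _ _ _ _ _ ca cs2.
  by rewrite /f; cont.
have pi0 : 0 <= (pi : R) by exact: pi_ge0.
have fodd : f pi = - f 0 by rewrite /f add0r !sper; ring.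
have [||t] := @IVT R f 0 pi 0 pi0.
- exact: continuous_subspaceT.
- by rewrite fodd ge_min le_max oppr_le0 oppr_ge0;
  case: (lerP 0 (f 0)) => [_|/ltW ->] /=; rewrite ?orbT.
rewrite in_itv /= => /andP[t0 tpi] ft.
have tK : K t by rewrite /K /= in_itv/= t0 (le_trans tpi)// lerDl.
have tK' : K (t + pi) by rewrite /K /= in_itv/= addr_ge0//= lerD2r.
have [e e0 [h1 h2]] := sq N t (leqnn _) tK.
have [e' e'0 [h1' h2']] := sq N _ (leqnn _) tK'.
move: h1' h2'; rewrite uN in h1 h2 *; rewrite codd dodd.
have := pos L t; rewrite lexx (ltW L0).
rewrite /K /= in_itv/= in tK => /(_ isT tK).
have := pos 0 0; rewrite lexx (ltW L0) addr_ge0// => /(_ isT isT).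
move: ft h1 h2; rewrite /f.
move: (s N t).1 (s N t).2 (s N (t + pi)).1 (s N (t + pi)).2 => x y x' y'.
move: (c (0,0)) (d (0,0)) (c (L, t)) (d (L, t)) => A B a b h0 h1 h2 p q h1' h2'.
(* At a zero of [f] the number [conj(s N t) s N (t + pi)] is real, yet its square is negative
   because the boundary values at [t] and [t + pi] are opposite. *)
have : (x' * x + y' * y) ^+ 2 =
    - (e * e' * (a ^+ 2 + b ^+ 2) * (A ^+ 2 + B ^+ 2)).
  transitivity ((x' ^+ 2 - y' ^+ 2) * (x ^+ 2 - y ^+ 2)
      + (x' * y' *+ 2) * (x * y *+ 2) + (y' * x - x' * y) ^+ 2); first ring.
  by rewrite h1 h2 h1' h2' h0; ring.
apply/eqP; rewrite gt_eqF// (@lt_le_trans _ _ 0) ?sqr_ge0// oppr_lt0.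
by rewrite !mulr_gt0.
Qed.

(** * Quaternion algebra and matrices of rotations *)

Section Quaternion.
Variable R : realType.
Implicit Types (p q r u v g : quat R).

Definition qconj q : quat R := qmk (qc q 0) (- qc q 1) (- qc q 2) (- qc q 3).
Definition qone : quat R := qmk 1 0 0 0.

Lemma qc_qmk (a b c d : R) k : (k < 4)%N ->
  qc (qmk a b c d) k = nth 0 [:: a; b; c; d] k.
Proof. by move=> k4; rewrite /qc mxE inordK. Qed.

Lemma qcK q (i : 'I_4) : qc q i = q ord0 i.
Proof. by rewrite /qc inord_val. Qed.

Lemma quatP p q : qc p 0 = qc q 0 -> qc p 1 = qc q 1 -> qc p 2 = qc q 2 ->
  qc p 3 = qc q 3 -> p = q.
Proof.
move=> h0 h1 h2 h3; apply/rowP => i; rewrite -!qcK.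
by case: i => -[|[|[|[|//]]]].
Qed.

Lemma qdotE p q : qdot p q =
  qc p 0 * qc q 0 + qc p 1 * qc q 1 + qc p 2 * qc q 2 + qc p 3 * qc q 3.
Proof. by rewrite /qdot !big_ord_recr big_ord0 /= add0r -!qcK. Qed.

Lemma qcD p q k : qc (p + q) k = qc p k + qc q k.
Proof. by rewrite /qc mxE. Qed.

Lemma qcN p k : qc (- p) k = - qc p k.
Proof. by rewrite /qc mxE. Qed.

Definition qE := (qcD, qcN, qc_qmk, qdotE).

Lemma qmulA : associative (@qmul R).
Proof. by move=> p q r; apply: quatP; rewrite /qmul !qE //=; ring. Qed.

Lemma qmulBl p q r : qmul (p - q) r = qmul p r - qmul q r.
Proof. by apply: quatP; rewrite /qmul !qE //=; ring. Qed.

Lemma qmulNl p q : qmul (- p) q = - qmul p q.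
Proof. by apply: quatP; rewrite /qmul !qE //=; ring. Qed.

Lemma qmulNr p q : qmul p (- q) = - qmul p q.
Proof. by apply: quatP; rewrite /qmul !qE //=; ring. Qed.

Lemma qconjM p q : qconj (qmul p q) = qmul (qconj q) (qconj p).
Proof. by apply: quatP; rewrite /qmul /qconj !qE //=; ring. Qed.

Lemma qdot_mul p q : qdot (qmul p q) (qmul p q) = qdot p p * qdot q q.
Proof. by rewrite /qmul !qE //=; ring. Qed.

Lemma qdot_conj p : qdot (qconj p) (qconj p) = qdot p p.
Proof. by rewrite /qconj !qE //=; ring. Qed.

Lemma RQQNN p q : RQQ (- p) (- q) = RQQ p q.
Proof.
by apply/matrixP => i j; rewrite [LHS]mxE [RHS]mxE !qmulNl qmulNr opprK.
Qed.

Lemma qc_delta (j : 'I_4) k : (k < 4)%N ->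
  qc (delta_mx ord0 j : quat R) k = (k == j)%:R.
Proof. by move=> k4; rewrite /qc mxE eqxx /= -val_eqE /= inordK. Qed.

Lemma RQQ_qc p q i j : RQQ p q i j = qc (qmul (qmul p (delta_mx ord0 j)) q) i.
Proof. by rewrite mxE qcK. Qed.

(* Matrix of the left ([e = 1]) or right ([e = -1]) multiplication by
   [a + b i + c j + d k]. *)
Definition qmul_mx (e a b c d : R) : 'M[R]_4 :=
  \matrix_(i < 4, j < 4) nth 0 (nth [::]
  [:: [:: a; - b; - c; - d]; [:: b; a; - (e * d); e * c];
   [:: c; e * d; a; - (e * b)]; [:: d; - (e * c); e * b; a]] i) j.

Lemma qmul_mxE e a b c d i j : qmul_mx e a b c d i j = nth 0 (nth [::]
  [:: [:: a; - b; - c; - d]; [:: b; a; - (e * d); e * c];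
   [:: c; e * d; a; - (e * b)]; [:: d; - (e * c); e * b; a]] i) j.
Proof. by rewrite mxE. Qed.

(** With left and right multiplication separated, orthogonality and the determinant can be computed
    on each factor. *)
Lemma RQQE p q : RQQ p q =
  qmul_mx 1 (qc p 0) (qc p 1) (qc p 2) (qc p 3) *m
  qmul_mx (-1) (qc q 0) (qc q 1) (qc q 2) (qc q 3).
Proof.
apply/matrixP => i j; rewrite RQQ_qc [RHS]mxE.
rewrite !big_ord_recr big_ord0 /= add0r !qmul_mxE.
case: i => -[|[|[|[|//]]]] ii; case: j => -[|[|[|[|//]]]] jj /=;
rewrite /qmul !qc_qmk //= !qc_delta //=; ring.
Qed.

Lemma qmul_mx_orth e a b c d : e * e = 1 ->
  (qmul_mx e a b c d)^T *m qmul_mx e a b c d =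
    (a * a + b * b + c * c + d * d)%:M.
Proof.
move=> ee; apply/matrixP => i j; rewrite [LHS]mxE [RHS]mxE.
rewrite !big_ord_recr big_ord0 /= add0r.
rewrite ![(_^T) _ _]mxE !qmul_mxE.
have ee' x y : (e * x) * (e * y) = x * y by rewrite mulrACA ee mul1r.
case: i => -[|[|[|[|//]]]] ii; case: j => -[|[|[|[|//]]]] jj /=;
rewrite -?val_eqE /= ?mulrNN ?mulrN ?mulNr ?ee' ?opprK; ring.
Qed.

Lemma det_qmul_mx e a b c d : e = 1 \/ e = -1 ->
  \det (qmul_mx e a b c d) = (a * a + b * b + c * c + d * d) ^+ 2.
Proof.
move=> he.
do 3 rewrite !(expand_det_row _ ord0) !big_ord_recr !big_ord0 /= /cofactor.
rewrite !det_mx11.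
rewrite !mxE /=.
by case: he => ->; ring.
Qed.

Lemma SO4_RQQ q : unitq q -> SO4 (RQQ q q).
Proof.
rewrite /unitq qdotE => h; rewrite RQQE; split.
  rewrite trmx_mul mulmxA -(mulmxA _ _ (qmul_mx 1 _ _ _ _)).
  rewrite qmul_mx_orth ?mul1r// h.
  by rewrite mulmx1 qmul_mx_orth ?mulrNN ?mul1r// h.
by rewrite det_mulmx !det_qmul_mx ?h ?expr1n ?mul1r//; [right | left].
Qed.

(** * Conjugation of pure unit quaternions *)

Definition qi : quat R := qmk 0 1 0 0.

Lemma qmul1l p : qmul qone p = p.
Proof. by apply: quatP; rewrite /qmul /qone !qE //=; ring. Qed.

Lemma qmul1r p : qmul p qone = p.
Proof. by apply: quatP; rewrite /qmul /qone !qE //=; ring. Qed.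

Lemma qmulBr p q r : qmul p (q - r) = qmul p q - qmul p r.
Proof. by apply: quatP; rewrite /qmul !qE //=; ring. Qed.

Lemma qmul_pure_unit u : qc u 0 = 0 -> qdot u u = 1 -> qmul u u = - qone.
Proof.
rewrite qdotE => u0 u1; apply: quatP; rewrite /qmul /qone !qE //= u0;
  by [ring|rewrite -u1 u0; ring].
Qed.

(** Since [u^2 = v^2 = -1], both sides equal [u + v]. *)
Lemma conj_step u v :
  qc u 0 = 0 -> qdot u u = 1 -> qc v 0 = 0 -> qdot v v = 1 ->
  qmul (qone - qmul v u) u = qmul v (qone - qmul v u).
Proof.
move=> u0 u1 v0 v1; rewrite qmulBl qmulBr qmul1l qmul1r.
rewrite -(qmulA v u u) (qmulA v v u).
by rewrite !qmul_pure_unit// qmulNl qmulNr qmul1l qmul1r !opprK addrC.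
Qed.

(** For pure [u] and [v] the scalar part of [1 - v u] is [1 + v . u]. *)
Lemma step_gt0 u v : qc u 0 = 0 -> qc v 0 = 0 -> 0 < 1 + qdot v u ->
  0 < qdot (qone - qmul v u) (qone - qmul v u).
Proof.
move=> u0 v0; set w := qone - qmul v u.
have -> : 1 + qdot v u = qc w 0.
  by rewrite /w /qone /qmul !qE //= u0 v0; ring.
rewrite qdotE -!expr2 => w0; rewrite -!addrA ltr_pwDl ?exprn_gt0//.
by rewrite !addr_ge0// sqr_ge0.
Qed.

Lemma qconjK q : qconj (qconj q) = q.
Proof. by apply: quatP; rewrite /qconj !qE //=; ring. Qed.

Lemma pure_conj q : qc q 0 = 0 -> qconj q = - q.
Proof. by move=> q0; apply: quatP; rewrite /qconj !qE //= q0; ring. Qed.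

(** The factor [1 - g i] works unless [g = - i], where it vanishes. *)
Lemma exists_conj_qi g : qc g 0 = 0 -> qdot g g = 1 ->
  exists2 w, 0 < qdot w w & qmul w qi = qmul g w.
Proof.
move=> g0 g1; have i0 : qc qi 0 = 0 by rewrite qc_qmk.
have i1 : qdot qi qi = 1 by rewrite /qi !qE //=; ring.
have [hg|hg] := ltP 0 (1 + qdot g qi).
  by exists (qone - qmul g qi); [exact: step_gt0|exact: conj_step].
have g1' : qc g 1 = qdot g qi by rewrite /qi !qE //=; ring.
(* [g . i <= -1] and [|g| = 1] force [g = - i]. *)
have [g2 [g3 gm1]] : qc g 2 = 0 /\ qc g 3 = 0 /\ qc g 1 = -1.
  rewrite -g1' in hg; move: g1; rewrite qdotE g0 => g1.
  have : 0 <= qc g 2 ^+ 2 by exact: sqr_ge0.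
  have : 0 <= qc g 3 ^+ 2 by exact: sqr_ge0.
  move=> h3 h2.
  have hh : 1 <= qc g 1 ^+ 2 by rewrite -sqrrN expr_ge1//; lra.
  have e2 : qc g 2 ^+ 2 = 0 by nra.
  have e3 : qc g 3 ^+ 2 = 0 by nra.
  have e1 : qc g 1 ^+ 2 = 1 by nra.
  move/eqP: e2; rewrite sqrf_eq0 => /eqP ->.
  move/eqP: e3; rewrite sqrf_eq0 => /eqP ->; do !split.
  by nra.
(* [j] conjugates [i] to [- i]. *)
exists (qmk 0 0 1 0); first by rewrite !qE //=; lra.
by apply: quatP; rewrite /qmul /qi !qE //= ?g0 ?g2 ?g3 ?gm1; ring.
Qed.

(** The span of [1] and [i] commutes with [i], so that part of [r] must vanish. *)
Lemma anticommute_qi r : qmul r qi = - qmul qi r -> qc r 0 = 0 /\ qc r 1 = 0.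
Proof.
move=> h; have := congr1 (fun q => qc q 0) h.
have := congr1 (fun q => qc q 1) h.
by rewrite /qmul /qi !qE //= => h1 h2; split; lra.
Qed.

(** * Continuity of quaternion-valued maps *)

(** Coordinatewise, so that goals concern real functions, within reach of [cont]. *)
Definition qcontinuous (T : topologicalType) (f : T -> quat R) :=
  forall k, (k < 4)%N -> continuous (fun t => qc (f t) k).
Arguments qcontinuous {T}.

Lemma qcontinuous_coords (T : topologicalType) (f : T -> quat R) :
  qcontinuous f -> [/\ continuous (fun t => qc (f t) 0),
    continuous (fun t => qc (f t) 1), continuous (fun t => qc (f t) 2) &
    continuous (fun t => qc (f t) 3)].
Proof.
by move=> cf; split; [exact: (cf 0%N) | exact: (cf 1%N) | exact: (cf 2%N) |
  exact: (cf 3%N)].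
Qed.

Lemma qcontinuous_qmk (T : topologicalType) (a b c d : T -> R) :
  continuous a -> continuous b -> continuous c -> continuous d ->
  qcontinuous (fun t => qmk (a t) (b t) (c t) (d t)).
Proof.
move=> ca cb cc cd k k4.
have -> : (fun t => qc (qmk (a t) (b t) (c t) (d t)) k) =
    (fun t => nth 0 [:: a t; b t; c t; d t] k).
  by apply/funext => t; rewrite qc_qmk.
by case: k k4 => [|[|[|[|//]]]].
Qed.

Lemma qcontinuousM (T : topologicalType) (f g : T -> quat R) :
  qcontinuous f -> qcontinuous g -> qcontinuous (fun t => qmul (f t) (g t)).
Proof.
move=> cf cg.
have [f0 f1 f2 f3] := qcontinuous_coords _ _ cf.
have [g0 g1 g2 g3] := qcontinuous_coords _ _ cg.
by apply: qcontinuous_qmk; cont.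
Qed.

Lemma qcontinuousB (T : topologicalType) (f g : T -> quat R) :
  qcontinuous f -> qcontinuous g -> qcontinuous (fun t => f t - g t).
Proof.
move=> cf cg k k4; have fk := cf k k4; have gk := cg k k4.
have -> : (fun t => qc (f t - g t) k) = (fun t => qc (f t) k - qc (g t) k).
  by apply/funext => t; rewrite qcD qcN.
by cont.
Qed.

Lemma qcontinuous_conj (T : topologicalType) (f : T -> quat R) :
  qcontinuous f -> qcontinuous (fun t => qconj (f t)).
Proof.
move=> cf.
have [f0 f1 f2 f3] := qcontinuous_coords _ _ cf.
by apply: qcontinuous_qmk; cont.
Qed.

Lemma qcontinuous_cst (T : topologicalType) q :
  qcontinuous (fun _ : T => q).
Proof. by move=> k k4; exact: continuousT_cst. Qed.

Lemma qcontinuous_comp (T U : topologicalType) (f : T -> U) (g : U -> quat R) :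
  continuous f -> qcontinuous g -> qcontinuous (fun t => g (f t)).
Proof.
by move=> cf cg k k4; exact: (continuousT_comp _ _ _ _ _ cf (cg k k4)).
Qed.

Lemma continuous_qdot (T : topologicalType) (f g : T -> quat R) :
  qcontinuous f -> qcontinuous g -> continuous (fun t => qdot (f t) (g t)).
Proof.
move=> cf cg.
have [f0 f1 f2 f3] := qcontinuous_coords _ _ cf.
have [g0 g1 g2 g3] := qcontinuous_coords _ _ cg.
have -> : (fun t => qdot (f t) (g t)) = (fun t => qc (f t) 0 * qc (g t) 0
    + qc (f t) 1 * qc (g t) 1 + qc (f t) 2 * qc (g t) 2
    + qc (f t) 3 * qc (g t) 3).
  by apply/funext => t; rewrite qdotE.
by cont.
Qed.

(** * Lifting along the meridians of the 3-sphere *)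

(* [g] is a map on S^3 in the coordinates [(a, (b, t))] of [polar] below
   ([a] being the distance to the pole, rescaled so that the equator is
   [a = L]). *)
Lemma no_odd_sphere_map (L : R) (g : R * (R * R) -> quat R) :
  0 < L -> qcontinuous g ->
  (forall z, qc (g z) 0 = 0) -> (forall z, qdot (g z) (g z) = 1) ->
  (forall y, g (0, y) = g (0, (0, 0))) ->
  (forall a t, g (a, (0, t)) = g (a, (0, 0))) ->
  (forall a t, g (a, (pi, t)) = g (a, (pi, 0))) ->
  (forall a b t, g (a, (b, t + (pi + pi))) = g (a, (b, t))) ->
  (forall b t, g (L, (pi - b, t + pi)) = - g (L, (b, t))) -> False.
Proof.
move=> L0 cg g0 g1 gpole glat0 glatpi gper godd.
(* Longitudes run up to [3 pi] because the antipodal map adds [pi] to a longitude in [[0, 2 pi]]. *)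
pose K := ([set` `[0 : R, pi]] `*`
  [set` `[0 : R, pi + (pi + pi)]] : set (R * R)).
have cK : compact K by apply: compact_setX; exact: segment_compact.
pose phi (z : (R * R) * (R * R)) := 1 + qdot (g (z.1.2, z.2)) (g (z.1.1, z.2)).
have cgT (T : topologicalType) (f : T -> R * (R * R)) :
    continuous f -> qcontinuous (fun t => g (f t)).
  by move=> cf; exact: qcontinuous_comp.
have cphi : continuous phi.
  have ? : continuous (fun z : (R * R) * (R * R) =>
      qdot (g (z.1.2, z.2)) (g (z.1.1, z.2))).
    by apply: continuous_qdot; apply: cgT; cont.
  by rewrite /phi; cont.
have phi0 a y : 0 <= a <= L -> K y -> 0 < phi ((a, a), y).
  by rewrite /phi /= g1 addr_gt0.
have [N [N0 hN]] := fine_subdivision R _ K L phi cK cphi L0 phi0.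
pose u k : R := L * k%:R / N%:R.
have u0 : u 0%N = 0 by rewrite /u mulr0 mul0r.
have uN : u N = L by rewrite /u mulfK// pnatr_eq0 -lt0n.
have [w w0 wi] := exists_conj_qi _ (g0 (0, (0, 0))) (g1 (0, (0, 0))).
pose st k y := qone - qmul (g (u k.+1, y)) (g (u k, y)).
(* The product of the factors met on the meridian [y] from the pole to [u k], started at [w], which
   conjugates [i] to the value of [g] at the pole. *)
pose q := fix q k y : quat R :=
  if k is j.+1 then qmul (st j y) (q j y) else w.
have qi_q k y : qmul (q k y) qi = qmul (g (u k, y)) (q k y).
  elim: k => [|k IH] /=; first by rewrite u0 gpole.
  by rewrite -qmulA IH !qmulA conj_step.
have qpos k y : (k <= N)%N -> K y -> 0 < qdot (q k y) (q k y).
  move=> + Ky; elim: k => [//|k IH kN] /=.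
  rewrite qdot_mul mulr_gt0 ?IH ?(ltnW kN)//.
  by apply: step_gt0 => //; exact: hN.
have cq k : qcontinuous (q k).
  elim: k => [|k IH] /=; first exact: qcontinuous_cst.
  apply: qcontinuousM IH; apply: qcontinuousB; first exact: qcontinuous_cst.
  by apply: qcontinuousM; apply: cgT; cont.
have q_ext k y y' : (forall a, g (a, y) = g (a, y')) -> q k y = q k y'.
  by move=> e; elim: k => //= k ->; rewrite /st !e.
(* The antipodal map of the equatorial 2-sphere. *)
pose ant (y : R * R) := (pi - y.1, y.2 + pi) : R * R.
pose r y := qmul (qconj (q N y)) (q N (ant y)).
have cr : qcontinuous r.
  apply: qcontinuousM; first exact: qcontinuous_conj.
  by apply: qcontinuous_comp (cq N); rewrite /ant; cont.
have q_anti b t : qmul (q N (ant (b, t))) qi =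
    - qmul (g (L, (b, t))) (q N (ant (b, t))).
  by rewrite qi_q uN /ant /= godd qmulNl.
have r01 b t : qc (r (b, t)) 0 = 0 /\ qc (r (b, t)) 1 = 0.
  apply: anticommute_qi; rewrite /r -qmulA q_anti qmulNr !qmulA.
  congr (- qmul _ _).
  (* Conjugating [q i = g q], with [i] and [g] pure, gives [i conj(q) = conj(q) g]. *)
  have := congr1 qconj (qi_q N (b, t)); rewrite !qconjM uN.
  rewrite (pure_conj qi) ?qc_qmk// (pure_conj _ (g0 _)).
  by rewrite qmulNl qmulNr => /eqP; rewrite eqr_opp => /eqP ->.
have cperiod k b t : q k (b, t + (pi + pi)) = q k (b, t).
  by apply: q_ext => a; exact: gper.
have rper b : r (b, pi + pi) = r (b, 0).
  rewrite /r /ant /=; congr (qmul (qconj _) _).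
    by have := cperiod N b 0; rewrite add0r.
  by rewrite -[RHS]cperiod; congr (q N (_, _)); ring.
have r0 t : r (0, t) = r (0, 0).
  rewrite /r /ant /= subr0; congr (qmul (qconj _) _); apply: q_ext => a.
    exact: glat0.
  by rewrite glatpi [RHS]glatpi.
(* On the circle [b = pi / 2] applying [ant] twice is a full turn, so [ant] turns [r] into its
   conjugate, which is [- r] as [r] lies in the span of [j] and [k]. *)
have rodd t : r (pi / 2, t + pi) = qconj (r (pi / 2, t)).
  rewrite /r /ant /= qconjM qconjK.
  have -> : pi - pi / 2 = pi / 2 :> R by field.
  by rewrite -addrA cperiod.
have pi20 : 0 < pi / 2 :> R by rewrite divr_gt0 ?pi_gt0.
have pi0 : 0 <= pi :> R by exact: pi_ge0.
(* The hemisphere [b <= pi / 2] of the 2-sphere is a disk with polar coordinates [(b, t)]. *)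
apply: (disk_odd_boundary_vanishes R (pi / 2) (fun y => qc (r y) 2)
  (fun y => qc (r y) 3)) => //.
- exact: cr.
- exact: cr.
- by move=> t; rewrite r0.
- by move=> t; rewrite r0.
- by move=> t; rewrite rper.
- by move=> t; rewrite rper.
- by move=> t; rewrite rodd qc_qmk.
- by move=> t; rewrite rodd qc_qmk.
move=> b t /andP[b0 b2] /andP[t0 t2].
have [ra rb] := r01 b t.
have : 0 < qdot (r (b, t)) (r (b, t)).
  rewrite /r qdot_mul qdot_conj mulr_gt0// qpos//; split; rewrite /= in_itv /=;
    apply/andP; split; lra.
by rewrite qdotE ra rb mul0r !add0r -!expr2.
Qed.

(** * The distance and the signs of the dot products *)

(** Expand [|p + q|^2 >= 0] and [|p - q|^2 >= 0]. *)
Lemma qdot_unit_itv p q : unitq p -> unitq q -> -1 <= qdot p q <= 1.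
Proof.
rewrite /unitq => hp hq.
have h e : e * e = 1 -> 0 <= 2 + 2 * e * qdot p q.
  move=> ee; have : 0 <= \sum_(i < 4) (p ord0 i + e * q ord0 i) ^+ 2.
    by apply: sumr_ge0 => i _; exact: sqr_ge0.
  have -> : \sum_(i < 4) (p ord0 i + e * q ord0 i) ^+ 2
      = qdot p p + e * e * qdot q q + 2 * e * qdot p q.
    by rewrite /qdot !mulr_sumr -!big_split /=; apply: eq_bigr => i _; ring.
  by rewrite hp hq ee mulr1.
have h1 := h 1 (mulr1 1); have h2 := h (-1) (etrans (mulrNN 1 1) (mulr1 1)).
by apply/andP; split; lra.
Qed.

Lemma acos_ge_pihalf (x : R) : -1 <= x <= 1 -> x <= 0 -> pi / 2 <= acos x.
Proof.
move=> hx x0; rewrite leNgt; apply/negP => h.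
have : 0 < cos (acos x).
  apply: cos_gt0_pihalf; rewrite h andbT (@lt_le_trans _ _ 0) ?acos_ge0//.
  by rewrite oppr_lt0 divr_gt0 ?pi_gt0.
by rewrite acosK ?in_itv//= ltNge x0.
Qed.

Lemma acos_le_pihalf (x : R) : -1 <= x <= 1 -> 0 <= x -> acos x <= pi / 2.
Proof.
move=> hx x0; have hx' : -1 <= - x <= 1 by apply/andP; split; lra.
have := acos_ge_pihalf _ hx'; rewrite oppr_le0 acosN// => /(_ x0); lra.
Qed.

(** A nonpositive product of cosines puts the two angles on either side of [pi / 2]. If
    [b <= pi / 2 <= a], the branches of the minimum yield [2 a] and [2 pi - 2 b], both at least
    [pi]. *)
Lemma d4_ge_pi (pL pR qL qR : quat R) :
  unitq pL -> unitq pR -> unitq qL -> unitq qR ->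
  qdot pL qL * qdot pR qR <= 0 -> pi <= d4 pL pR qL qR.
Proof.
move=> hpL hpR hqL hqR; rewrite /d4 /dQ.
have := qdot_unit_itv _ _ hpL hqL; have := qdot_unit_itv _ _ hpR hqR.
move: (qdot pL qL) (qdot pR qR) => x y hy hx xy.
have key (a b : R) : pi / 2 <= a -> b <= pi / 2 ->
    pi <= Num.min (a + b) (2 * pi - a - b) + `|a - b|.
  move=> ha hb; rewrite ger0_norm; last by lra.
  by rewrite addr_minl le_min; apply/andP; split; lra.
have key' (a b : R) : a <= pi / 2 -> pi / 2 <= b ->
    pi <= Num.min (a + b) (2 * pi - a - b) + `|a - b|.
  move=> ha hb; have := key b a hb ha.
  by rewrite distrC (addrC b) -!addrA (addrC (- b)).
have [x0|x0] := leP 0 x.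
  have [y0|y0] := leP 0 y; last first.
    by apply: key'; [exact: acos_le_pihalf|exact/acos_ge_pihalf/ltW].
  have : x * y == 0 by rewrite eq_le xy mulr_ge0.
  rewrite mulf_eq0 => /orP[] /eqP z0; rewrite z0 in x0 y0 hx hy *.
    by apply: key; [exact: acos_ge_pihalf|exact: acos_le_pihalf].
  by apply: key'; [exact: acos_le_pihalf|exact: acos_ge_pihalf].
have y0 : 0 <= y by rewrite -(nmulr_rle0 _ x0).
by apply: key; [exact/acos_ge_pihalf/ltW|exact: acos_le_pihalf].
Qed.

(** If [x] and [y] had the same strict sign, both summands would have it too. *)
Lemma sign_combination (x y : R) : x * `|y| + `|x| * y = 0 -> x * y <= 0.
Proof.
move=> h; rewrite leNgt; apply/negP => xy.
have [x0|x0|x0] := ltgtP x 0; last by rewrite x0 mul0r ltxx in xy.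
- have y0 : y < 0 by rewrite nmulr_rgt0 in xy.
  by move: h; rewrite !ltr0_norm//; nra.
- have y0 : 0 < y by rewrite pmulr_rgt0 in xy.
  by move: h; rewrite !gtr0_norm//; nra.
Qed.

(** * Spherical coordinates and Borsuk-Ulam on the 3-sphere *)

(** [z.1] is the angle from the pole [1]; [z.2] is the colatitude from [i] and the longitude of the
    pure part. *)
Definition polar (z : R * (R * R)) : quat R :=
  qmk (cos z.1) (sin z.1 * cos z.2.1) (sin z.1 * (sin z.2.1 * cos z.2.2))
      (sin z.1 * (sin z.2.1 * sin z.2.2)).

Lemma unitq_polar z : unitq (polar z).
Proof.
case: z => a [b t]; rewrite /unitq /polar !qE //=.
transitivity (cos a ^+ 2 + sin a ^+ 2 *
    (cos b ^+ 2 + sin b ^+ 2 * (cos t ^+ 2 + sin t ^+ 2))).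
  by ring.
by rewrite !(cos2Dsin2, mulr1).
Qed.

Lemma qcontinuous_continuous (T : topologicalType) (f : T -> quat R) :
  qcontinuous f -> continuous f.
Proof.
move=> cf; apply: continuous_mx => i j; rewrite (ord1 i).
have -> : (fun t => f t ord0 j) = (fun t => qc (f t) j).
  by apply/funext => t; rewrite qcK.
exact: cf.
Qed.

Lemma continuous_qc k : continuous (fun q : quat R => qc q k).
Proof. by move=> q; exact: coord_continuous. Qed.

Lemma continuous_polar : continuous polar.
Proof.
apply: qcontinuous_continuous.
by apply: qcontinuous_qmk; cont.
Qed.

(** Without a common zero, [(h1, h2, h3)] normalizes to a pure unit quaternion; pulled back by
    [polar], it is an odd map excluded by [no_odd_sphere_map]. *)
Lemma borsuk_ulam_S3 (h1 h2 h3 : quat R -> R) :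
  {within [set q | unitq q], continuous h1} ->
  {within [set q | unitq q], continuous h2} ->
  {within [set q | unitq q], continuous h3} ->
  (forall q, unitq q -> h1 (- q) = - h1 q) ->
  (forall q, unitq q -> h2 (- q) = - h2 q) ->
  (forall q, unitq q -> h3 (- q) = - h3 q) ->
  exists q, [/\ unitq q, h1 q = 0, h2 q = 0 & h3 q = 0].
Proof.
move=> c1 c2 c3 o1 o2 o3; apply: contrapT => no0.
pose n q := Num.sqrt (h1 q ^+ 2 + h2 q ^+ 2 + h3 q ^+ 2).
have n0 q : unitq q -> 0 < h1 q ^+ 2 + h2 q ^+ 2 + h3 q ^+ 2.
  move=> uq; rewrite lt_neqAle !addr_ge0 ?sqr_ge0// andbT eq_sym; apply/negP.
  rewrite !paddr_eq0 ?addr_ge0 ?sqr_ge0// !sqrf_eq0.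
  move=> /andP[/andP[/eqP h1q /eqP h2q] /eqP h3q].
  by apply: no0; exists q.
have ch (h : quat R -> R) : {within [set q | unitq q], continuous h} ->
    continuous (fun z => h (polar z)).
  move=> ch; apply/continuous_subspace_setT.
  exact: within_comp ch continuous_polar (fun z _ => unitq_polar z).
have := ch _ c1; have := ch _ c2; have := ch _ c3 => {ch} c3' c2' c1'.
have nz z : 0 < n (polar z) by rewrite sqrtr_gt0 n0//; exact: unitq_polar.
have cn : continuous (fun z => n (polar z)) by rewrite /n; cont.
have cnV : continuous (fun z => (n (polar z))^-1).
  by apply: (continuousTV _ _ _ cn) => z; rewrite gt_eqF.
pose g z : quat R := qmk 0 (h1 (polar z) * (n (polar z))^-1)
  (h2 (polar z) * (n (polar z))^-1) (h3 (polar z) * (n (polar z))^-1).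
(* The identifications required of [g] thus reduce to identities of [polar]. *)
have gE z z' : polar z = polar z' -> g z = g z' by rewrite /g => ->.
have cosP x : cos (x + pi) = - cos x :> R by exact: cosDpi.
have sinP x : sin (x + pi) = - sin x :> R by exact: sinDpi.
have cospiB x : cos (pi - x) = - cos x :> R by rewrite addrC cosP cosN.
have sinpiB x : sin (pi - x) = sin x :> R by rewrite addrC sinP sinN opprK.
apply: (no_odd_sphere_map (pi / 2) g).
- by rewrite divr_gt0 ?pi_gt0.
- by apply: qcontinuous_qmk; cont.
- by move=> z; rewrite qc_qmk.
- move=> z; rewrite /g !qE //=.
  have : n (polar z) ^+ 2 =
      h1 (polar z) ^+ 2 + h2 (polar z) ^+ 2 + h3 (polar z) ^+ 2.
    by rewrite sqr_sqrtr// ltW// n0//; exact: unitq_polar.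
  move: (nz z); move: (n _) (h1 _) (h2 _) (h3 _) => m x y w m0 hm.
  have mN0 : m != 0 by rewrite gt_eqF.
  transitivity ((x ^+ 2 + y ^+ 2 + w ^+ 2) / m ^+ 2); first by field.
  by rewrite -hm divff// sqrf_eq0.
- by move=> y; apply: gE; rewrite /polar /= sin0 !mul0r.
- by move=> a t; apply: gE; rewrite /polar /= sin0 !mul0r.
- by move=> a t; apply: gE; rewrite /polar /= sinpi !mul0r.
- by move=> a b t; apply: gE; rewrite /polar /= (addrA t) !(cosP, sinP) !opprK.
move=> b t.
have uz := unitq_polar (pi / 2, (b, t)).
(* On the equator the scalar part is zero, so only the direction in the 2-sphere is reversed. *)
have e : polar (pi / 2, (pi - b, t + pi)) = - polar (pi / 2, (b, t)).
  apply: quatP; rewrite /polar !qE //= ?cos_pihalf ?oppr0// sin_pihalf !mul1r.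
  + exact: cospiB.
  + by rewrite sinpiB cosP mulrN.
  + by rewrite sinpiB sinP mulrN.
rewrite /g e /n !o1// !o2// !o3// !sqrrN.
by apply: quatP; rewrite !qE //= ?oppr0// mulNr.
Qed.

(** * From maps on rotations to odd functions on the 3-sphere *)

Lemma continuous_RQQ_diag : continuous (fun q : quat R => RQQ q q).
Proof.
apply: continuous_mx => i j.
have -> : (fun q : quat R => RQQ q q i j) =
    (fun q => qc (qmul (qmul q (delta_mx ord0 j)) q) i).
  by apply/funext => q; rewrite RQQ_qc.
have cid : qcontinuous (fun q : quat R => q).
  by move=> k _; exact: continuous_qc.
have cc : qcontinuous (fun q : quat R => qmul (qmul q (delta_mx ord0 j)) q).
  apply: qcontinuousM => //; apply: qcontinuousM => //; exact: qcontinuous_cst.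
exact: cc (ltn_ord i).
Qed.

(** The product [x * y] is even in [q]. This combination is odd; it is 0 if [x] and [y] have
    opposite signs and [2 x |y|] if they have the same sign. *)
Definition agreement (f : 'M[R]_4 -> quat R * quat R) (q : quat R) : R :=
  let x := qdot q (f (RQQ q q)).1 in let y := qdot q (f (RQQ q q)).2 in
  x * `|y| + `|x| * y.

Lemma agreementN f q : agreement f (- q) = - agreement f q.
Proof.
rewrite /agreement RQQNN.
have dN r : qdot (- q) r = - qdot q r by rewrite !qE; ring.
by rewrite !dN !normrN; ring.
Qed.

Lemma continuous_agreement f : {within @SO4 R, continuous f} ->
  {within [set q | unitq q], continuous (agreement f)}.
Proof.
move=> cf.
have c : continuous (fun q : subspace [set q | @unitq R q] => f (RQQ q q)).
  exact: within_comp cf continuous_RQQ_diag SO4_RQQ.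
have cid : qcontinuous (fun q : subspace [set q | @unitq R q] => (q : quat R)).
  by move=> k _; apply: continuous_subspaceT; exact: continuous_qc.
have cq k : continuous (fun q : quat R => qc q k) by exact: continuous_qc.
have c1 : qcontinuous (fun q : subspace [set q | @unitq R q] =>
    (f (RQQ q q)).1).
  by move=> k _; apply: continuousT_comp (cq k); exact: continuousT_fst.
have c2 : qcontinuous (fun q : subspace [set q | @unitq R q] =>
    (f (RQQ q q)).2).
  by move=> k _; apply: continuousT_comp (cq k); exact: continuousT_snd.
have d1 := continuous_qdot _ _ _ cid c1.
have d2 := continuous_qdot _ _ _ cid c2.
(* Continuity within a set is by definition continuity on its [subspace] type, a form that [cont]
   decomposes. *)
change (continuous (fun q : subspace [set q | @unitq R q] => agreement f q)).
by rewrite /agreement; cbv zeta; cont.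
Qed.

End Quaternion.

Theorem theorem12 (R : realType)
  (f1 f2 f3 : 'M[R]_4 -> quat R * quat R) :
  {within @SO4 R, continuous f1} ->
  {within @SO4 R, continuous f2} ->
  {within @SO4 R, continuous f3} ->
  (forall M, @SO4 R M -> unitq (f1 M).1 /\ unitq (f1 M).2) ->
  (forall M, @SO4 R M -> unitq (f2 M).1 /\ unitq (f2 M).2) ->
  (forall M, @SO4 R M -> unitq (f3 M).1 /\ unitq (f3 M).2) ->
  exists pL pR : quat R, unitq pL /\ unitq pR /\
    let M := RQQ pL pR in
    [/\ pi <= d4 pL pR (f1 M).1 (f1 M).2,
        pi <= d4 pL pR (f2 M).1 (f2 M).2 &
        pi <= d4 pL pR (f3 M).1 (f3 M).2].
Proof.
move=> c1 c2 c3 u1 u2 u3.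
have [q [uq z1 z2 z3]] := borsuk_ulam_S3 R _ _ _
  (continuous_agreement _ _ c1) (continuous_agreement _ _ c2)
  (continuous_agreement _ _ c3)
  (fun q _ => agreementN _ f1 q) (fun q _ => agreementN _ f2 q)
  (fun q _ => agreementN _ f3 q).
have far f : (forall M, @SO4 R M -> unitq (f M).1 /\ unitq (f M).2) ->
    agreement R f q = 0 -> pi <= d4 q q (f (RQQ q q)).1 (f (RQQ q q)).2.
  move=> /(_ _ (SO4_RQQ _ _ uq))[v1 v2] zf.
  by apply: d4_ge_pi => //; exact: sign_combination.
by exists q, q; split => //; split => //; split; exact: far.
Qed.
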